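(* Let $\gamma$ be a singular graphon. For any join-transitive graph $F=F_1\bowtie F_2\bowtie\cdots\bowtie F_r$ (that is, $F$ is obtained by recursive junction of the transitive graphs $F_1,\ldots,F_r$), $$t(F,\gamma)=\prod_{i=1}^r t(F_i,\gamma).$$
   Context: Graphs are finite, simple and undirected, with at least one vertex. A graph function is a measurable symmetric $g:[0,1]^2\to[0,1]$ (up to null sets); a graphon $\gamma=[g]$ is an equivalence class of graph functions for the relation $\delta_\square=0$, where $\delta_\square$ is the cut-metric $\inf_\sigma \sup_{S,T}|\int_{S\times T}(g_1(\sigma(x),\sigma(y))-g_2(x,y))\,dx\,dy|$, $\sigma$ running over measure-preserving measurable bijections of $[0,1]$ and $S,T$ over measurable subsets. For a graph $F$ on $\{1,\dots,k\}$, $t(F,\gamma)=\int_{[0,1]^k}\prod_{\{i,j\}\in E_F}g(x_i,x_j)\,dx_1\cdots dx_k$. For graphs $F_1,F_2$ on $k_1,k_2$ vertices, $F_1F_2$ is their disjoint union and $(F_1\bowtie F_2)(i_1,i_2)$ is the graph on $k_1+k_2-1$ vertices obtained from it by identifying vertex $i_1$ of $F_1$ with vertex $i_2$ of $F_2$. The graphon $\gamma$ is singular if for all finite graphs $F_1,F_2$, $t(F_1F_2,\gamma)=\frac1{k_1k_2}\sum_{i_1=1}^{k_1}\sum_{i_2=1}^{k_2}t((F_1\bowtie F_2)(i_1,i_2),\gamma)$. A graph is transitive if its automorphism group acts transitively on its vertices. A graph $F$ is join-transitive if there are transitive graphs $F_1,\dots,F_r$ and vertices $(i_1,j_1)\in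 V_{F_1}\times V_{F_2}$, $(i_2,j_2)\in V_{(F_1\bowtie F_2)(i_1,j_1)}\times V_{F_3}$, etc., such that $F=(\cdots((F_1\bowtie F_2)(i_1,j_1)\bowtie F_3)(i_2,j_2)\cdots\bowtie F_r)(i_{r-1},j_{r-1})$; one then writes $F=F_1\bowtie\cdots\bowtie F_r$, omitting the vertices of junction. *)

(* Defs.v *)
From HB Require Import structures.
From mathcomp Require Import all_boot all_order all_algebra.
From mathcomp Require Import all_classical all_reals all_analysis.

Set Implicit Arguments.
Unset Strict Implicit.
Unset Printing Implicit Defensive.

Import Order.TTheory GRing.Theory Num.Theory.
Import numFieldNormedType.Exports.

Local Open Scope classical_set_scope.
Local Open Scope ring_scope.

Record sgraph := SGraph {
  vertex :> finType;
  edge : rel vertex;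
  edge_sym : symmetric edge;
  edge_irr : irreflexive edge;
  vertex_gt0 : (0 < #|vertex|)%N }.

Definition graph_iso (F G : sgraph) (f : F -> G) : Prop :=
  bijective f /\ {mono f : x y / edge x y}.

Definition isomorphic (F G : sgraph) : Prop :=
  exists f : F -> G, graph_iso f.

Definition vertex_transitive (F : sgraph) : Prop :=
  forall x y : F, exists2 f : F -> F, graph_iso f & f x = y.

Section disjoint_union.
Variables F1 F2 : sgraph.

Definition dunion_rel : rel (F1 + F2)%type := fun u v =>
  match u, v with
  | inl x, inl y => edge x y
  | inr x, inr y => edge x y
  | _, _ => false
  end.

Lemma dunion_sym : symmetric dunion_rel.
Proof. by case=> x [] y //=; rewrite edge_sym. Qed.

Lemma dunion_irr : irreflexive dunion_rel.
Proof. by case=> x /=; rewrite edge_irr. Qed.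

Lemma dunion_gt0 : (0 < #|{: F1 + F2}|)%N.
Proof. by rewrite card_sum addn_gt0 vertex_gt0. Qed.

Definition dunion : sgraph := SGraph dunion_sym dunion_irr dunion_gt0.

End disjoint_union.

(* The vertex i2 of F2 is removed and its neighbours are attached to i1. *)
Section junction.
Variables (F1 F2 : sgraph) (i1 : F1) (i2 : F2).

Definition junction_vertex : finType := (F1 + {y : F2 | y != i2})%type.

Definition junction_rel : rel junction_vertex := fun u v =>
  match u, v with
  | inl x, inl y => edge x y
  | inr x, inr y => edge (val x) (val y)
  | inl x, inr y => (x == i1) && edge i2 (val y)
  | inr x, inl y => (y == i1) && edge i2 (val x)
  end.

Lemma junction_sym : symmetric junction_rel.
Proof. by case=> x [] y //=; rewrite edge_sym. Qed.

Lemma junction_irr : irreflexive junction_rel.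
Proof. by case=> x /=; rewrite edge_irr. Qed.

Lemma junction_gt0 : (0 < #|junction_vertex|)%N.
Proof. by rewrite card_sum addn_gt0 vertex_gt0. Qed.

Definition junction : sgraph := SGraph junction_sym junction_irr junction_gt0.

End junction.

Inductive iterated_junction : seq sgraph -> sgraph -> Prop :=
| Junction1 F : vertex_transitive F -> iterated_junction [:: F] F
| JunctionS s (F F' : sgraph) (i : F) (j : F') :
    iterated_junction s F -> vertex_transitive F' ->
    iterated_junction (rcons s F') (junction i j).

(* The labelling of the vertices of a junction is immaterial, whence the      *)
(* isomorphism.                                                               *)
Definition join_transitive_of (s : seq sgraph) (F : sgraph) : Prop :=
  exists2 F' : sgraph, iterated_junction s F' & isomorphic F F'.

Definition I01 (R : realType) : set R := `[0%R, 1%R]%classic.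
Arguments I01 {R}.

Section unit_cube.
Variable R : realType.

Definition lebesgue01 : set R -> \bar R :=
  fun A => lebesgue_measure (A `&` I01).

Let mrestr01 : {measure set (measurableTypeR R) -> \bar R} :=
  mrestr lebesgue_measure (measurable_itv `[0%R, 1%R]).

Let lebesgue01_0 : lebesgue01 set0 = 0%E.
Proof. exact: (measure0 mrestr01). Qed.

Let lebesgue01_ge0 A : (0 <= lebesgue01 A)%E.
Proof. exact: (measure_ge0 mrestr01). Qed.

Let lebesgue01_sigma_additive : semi_sigma_additive lebesgue01.
Proof. exact: (@measure_semi_sigma_additive _ _ _ mrestr01). Qed.

HB.instance Definition _ := isMeasure.Build _ _ _ lebesgue01
  lebesgue01_0 lebesgue01_ge0 lebesgue01_sigma_additive.

Lemma lebesgue01_setT : lebesgue01 setT = 1%E.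
Proof.
rewrite /lebesgue01 /I01 setTI lebesgue_measure_itv /= lte_fin ltr01.
by rewrite -EFinB subr0.
Qed.

HB.instance Definition _ :=
  Measure_isProbability.Build _ _ _ lebesgue01 lebesgue01_setT.

Definition tcons n (p : R * n.-tuple R) : n.+1.-tuple R :=
  [tuple of p.1 :: p.2].

Lemma measurable_tcons n : measurable_fun setT (@tcons n).
Proof. exact: measurable_cons. Qed.

HB.instance Definition _ n :=
  isMeasurableFun.Build _ _ _ _ (@tcons n) (@measurable_tcons n).

(* The n-th power of lebesgue01, i.e. Lebesgue measure on [0, 1]^n, extended  *)
(* by 0 to R^n.                                                               *)
Fixpoint lebesgue_cube n : probability (n.-tuple R) R :=
  match n with
  | 0 => dirac [tuple]
  | n'.+1 => distribution (lebesgue01 \x lebesgue_cube n')%E (@tcons n')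
  end.

Definition cube n : set (n.-tuple R) :=
  [set x | forall i, tnth x i \in `[0, 1]].

End unit_cube.

(* The values outside [0, 1]^2 are irrelevant. Measurability is Borel: every  *)
(* Lebesgue-measurable function agrees almost everywhere with a Borel one.    *)
Record graph_function (R : realType) := GraphFunction {
  gfun :> R -> R -> R;
  gfun_measurable : measurable_fun (I01 `*` I01)
    (fun p : R * R => gfun p.1 p.2);
  gfun_sym : {in `[0, 1] &, forall x y, gfun x y = gfun y x};
  gfun_itv : {in `[0, 1] &, forall x y, gfun x y \in `[0, 1]} }.

Section graphon.
Variable R : realType.
Implicit Types g h : graph_function R.

Definition measure_preserving_bijection (s : R -> R) : Prop :=
  [/\ set_bij I01 I01 s, measurable_fun I01 s &
      forall A, measurable A ->
        lebesgue01 (I01 `&` s @^-1` A) = lebesgue01 A].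

Definition cut_discrepancy (s : R -> R) g h : \bar R :=
  ereal_sup [set z | exists S T : set R,
    [/\ measurable S /\ S `<=` I01, measurable T /\ T `<=` I01 &
      z = `| \int[(@lebesgue01 R \x @lebesgue01 R)%E]_(p in S `*` T)
              (g (s p.1) (s p.2) - h p.1 p.2)%:E |%E]].

Definition cut_metric g h : \bar R :=
  ereal_inf [set cut_discrepancy s g h | s in measure_preserving_bijection].

Definition cut_class g : set (graph_function R) :=
  [set h | cut_metric g h = 0%E].

Lemma cut_class_refl g : cut_class g g.
Proof.
have mpid : measure_preserving_bijection id.
  split; [|exact: measurable_id|].
    by split=> // x Ix; exists x.
  move=> A mA; rewrite /lebesgue01 preimage_id.
  by rewrite [in LHS](setIC I01) -setIA setIid.
have dge0 s h : (0 <= cut_discrepancy s g h)%E.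
  apply: ereal_sup_ubound; exists set0, set0; split; try by split.
  by rewrite setX0 integral_set0 abse0.
apply/eqP; rewrite eq_le; apply/andP; split; last first.
  by apply: le_ereal_inf_tmp => _ [s _ <-].
apply: ereal_inf_lbound; exists id => //.
apply/eqP; rewrite eq_le dge0 andbT; apply: ge_ereal_sup => _ [S [T [_ _ ->]]].
by under eq_integral do rewrite subrr; rewrite integral0 abse0.
Qed.

Definition is_graphon (G : set (graph_function R)) : Prop :=
  exists g, G = cut_class g.

End graphon.

Record graphon (R : realType) := Graphon {
  graphon_class : set (graph_function R);
  graphonP : is_graphon graphon_class }.

Definition graphon_of (R : realType) (g : graph_function R) : graphon R :=
  Graphon (ex_intro _ g (erefl (cut_class g))).

Section hom_density.
Variable R : realType.

Definition graphon_repr (gamma : graphon R) : graph_function R :=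
  projT1 (cid (graphonP gamma)).

Lemma graphon_reprE (gamma : graphon R) :
  graphon_class gamma = cut_class (graphon_repr gamma).
Proof. exact: projT2 (cid (graphonP gamma)). Qed.

Lemma graphon_reprP (gamma : graphon R) :
  graphon_class gamma (graphon_repr gamma).
Proof. by rewrite graphon_reprE; exact: cut_class_refl. Qed.

(* enum_rank numbers the vertices of F, so that each edge {a, b} is counted   *)
(* once, as the pair with the smaller number first.                           *)
Definition gf_hom_density (F : sgraph) (g : graph_function R) : R :=
  \int[lebesgue_cube R #|F|]_(x in @cube R #|F|)
    \prod_(e : F * F | (enum_rank e.1 < enum_rank e.2)%N && edge e.1 e.2)
      g (tnth x (enum_rank e.1)) (tnth x (enum_rank e.2)).

(* gf_hom_density F is invariant under the cut metric, so the choice of the   *)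
(* representative does not matter.                                            *)
Definition hom_density (F : sgraph) (gamma : graphon R) : R :=
  gf_hom_density F (graphon_repr gamma).

Definition singular (gamma : graphon R) : Prop :=
  forall F1 F2 : sgraph,
    hom_density (dunion F1 F2) gamma =
    (#|F1|%:R * #|F2|%:R)^-1 *
      \sum_(i1 : F1) \sum_(i2 : F2) hom_density (junction i1 i2) gamma.

End hom_density.

(* Main.v *)
Require Import Defs.
From mathcomp Require Import all_boot all_order all_algebra.
From mathcomp Require Import all_classical all_reals all_analysis.
From mathcomp Require Import measurable_realfun.
From mathcomp Require Import ring lra.
Set Implicit Arguments.
Unset Strict Implicit.
Unset Printing Implicit Defensive.
Import Order.TTheory GRing.Theory Num.Theory.
Import numFieldNormedType.Exports.
Local Open Scope classical_set_scope.
Local Open Scope ring_scope.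

(** Write f_(F,i)(t) for the rooted density of a graph F at its vertex i: the
    integral defining t(F, gamma) with the variable of i fixed to t. Its mean
    over t is t(F, gamma) ([Rintegral_rooted_density]), and since the two parts
    of a junction share only the identified vertex, conditioning on that vertex
    makes them independent ([gf_hom_density_junction]):

      t((F1 |><| F2)(i1, i2), gamma) = \int f_(F1,i1)(t) f_(F2,i2)(t) dt.

    If F' is transitive, an automorphism carries any vertex to any other, so
    f_(F',j) does not depend on j ([rooted_density_iso]). Singularity, applied to
    the disjoint union of F' with itself, then says that the second moment of
    f_(F',j) is t(F', gamma)^2, the square of its mean: f_(F',j) has zero variance
    and is almost everywhere the constant t(F', gamma). Hence for every graph F,

      t((F |><| F')(i, j), gamma) = \int f_(F,i) f_(F',j) = t(F, gamma) t(F', gamma)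

    ([hom_density_junction_transitive]), and the theorem follows by induction
    on the number of transitive factors.

    All changes of variables are instances of one principle: a homomorphism
    density may be computed on any probability space that carries independent
    uniform variables indexed by the vertices ([gf_hom_density_iid]). Such
    families are stable under disjoint union, on a product space, and under
    injective reindexing; this yields the relabellings, the splitting of
    disjoint unions and the conditioning on a vertex. *)

(** * Families of independent uniform variables *)

Section iid_families.
Variable R : realType.
Local Open Scope ereal_scope.

(** The law of the family is prescribed on all boxes at once, which expresses
    uniformity of each variable and mutual independence together: a box may be
    the whole line in the coordinates that are to be ignored. *)
Definition iid_uniform d (Omega : measurableType d) (P : probability Omega R)
    (T : finType) (X : Omega -> T -> R) : Prop :=
  (forall a, measurable_fun setT (X ^~ a)) /\
  forall A : T -> set R, (forall a, measurable (A a)) ->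
    P [set w | forall a, A a (X w a)] = \prod_(a : T) lebesgue01 (A a).

Lemma measurable_box d (Omega : measurableType d) (T : finType)
    (X : Omega -> T -> R) (A : T -> set R) :
  (forall a, measurable_fun setT (X ^~ a)) -> (forall a, measurable (A a)) ->
  measurable [set w | forall a, A a (X w a)].
Proof.
move=> mX mA.
rewrite (_ : [set _ | _] = \bigcap_(a in [set: T]) (X ^~ a @^-1` A a)).
  apply: fin_bigcap_measurable => // a _.
  by rewrite -[_ @^-1` _]setTI; exact: mX.
by apply/seteqP; split=> [w Aw a _|w Aw a]; [exact: Aw|exact: (Aw a I)].
Qed.

Lemma iid_uniform_sum d1 d2 (Omega1 : measurableType d1)
    (Omega2 : measurableType d2) (P1 : probability Omega1 R)
    (P2 : probability Omega2 R) (T1 T2 : finType)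
    (X1 : Omega1 -> T1 -> R) (X2 : Omega2 -> T2 -> R) :
  iid_uniform P1 X1 -> iid_uniform P2 X2 ->
  iid_uniform (P1 \x P2) (fun w (a : T1 + T2) =>
    match a with inl a1 => X1 w.1 a1 | inr a2 => X2 w.2 a2 end).
Proof.
move=> [mX1 PX1] [mX2 PX2]; split=> [[a|a]|A mA].
- exact: (measurableT_comp (mX1 a)).
- exact: (measurableT_comp (mX2 a)).
rewrite big_sumType -PX1// -PX2//.
rewrite (_ : [set _ | _] =
    [set w1 | forall a, A (inl a) (X1 w1 a)] `*`
    [set w2 | forall a, A (inr a) (X2 w2 a)]).
  apply: product_measure1E.
    exact: (@measurable_box _ _ _ X1 (fun a => A (inl a))).
  exact: (@measurable_box _ _ _ X2 (fun a => A (inr a))).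
apply/seteqP; split=> [w Aw|w [A1w A2w] [a|a]].
- by split=> a /=; [exact: (Aw (inl a))|exact: (Aw (inr a))].
- exact: A1w.
- exact: A2w.
Qed.

(** Taking the whole line for the variables outside the image of [f] turns a box
    over [S] into a box over [T] of the same measure. *)
Lemma iid_uniform_reindex d (Omega : measurableType d)
    (P : probability Omega R) (S T : finType) (X : Omega -> T -> R)
    (f : S -> T) :
  injective f -> iid_uniform P X -> iid_uniform P (fun w a => X w (f a)).
Proof.
move=> finj [mX PX]; split=> [a|A mA]; first exact: mX.
pose f' t := [pick a | f a == t].
have f'K a : f' (f a) = Some a.
  by rewrite /f'; case: pickP => [b /eqP/finj->//|/(_ a)]; rewrite eqxx.
pose B t := if f' t is Some a then A a else setT.
have BE a : B (f a) = A a by rewrite /B f'K.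
rewrite (_ : [set _ | _] = [set w | forall t, B t (X w t)]); last first.
  apply/seteqP; split=> [w Aw t|w Bw a /=]; last first.
    by have := Bw (f a); rewrite BE.
  by rewrite /B /f'; case: pickP => // a /eqP <-; exact: Aw.
rewrite PX; last by move=> t; rewrite /B; case: (f' t).
rewrite (bigID (fun t => isSome (f' t)))/= [X in _ * X]big1 ?mule1; last first.
  by move=> t; rewrite /B; case: (f' t) => //= _; exact: lebesgue01_setT.
rewrite (reindex_omap f f') /=.
  apply: eq_big => [a|a _]; last by rewrite BE.
  by rewrite f'K eqxx.
by move=> t; rewrite /f'; case: pickP => //= a /eqP ->.
Qed.

Lemma iid_uniform1 :
  iid_uniform (@lebesgue01 R) (fun (t : measurableTypeR R) (_ : unit) => t).
Proof.
split=> [_|A mA]; first exact: measurable_id.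
rewrite (big_pred1 tt) => [|[]//]; congr lebesgue01.
by apply/seteqP; split=> [w /(_ tt)//|w Aw []].
Qed.

Lemma iid_uniform_cube n : iid_uniform (lebesgue_cube R n) (@tnth n R).
Proof.
elim: n => [|n IH].
  split=> [[]//|A mA]; rewrite big_ord0 /= /dirac indicE mem_set//.
  by case.
split=> [i|A mA]; first exact: measurable_tnth.
have [mX PX] := iid_uniform_sum iid_uniform1 IH.
pose h (i : 'I_n.+1) : (unit + 'I_n)%type :=
  if unlift ord0 i is Some j then inr j else inl tt.
have hinj : injective h.
  by move=> i j; rewrite /h; case: unliftP => [i' ->|->];
    case: unliftP => [j' ->|->]// [->].
have [_ <-//] := iid_uniform_reindex hinj (conj mX PX).
rewrite [LHS]/= /pushforward.
congr (product_measure1 _ _ _); apply/seteqP.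
split=> w Aw i; have := Aw i; rewrite /h;
  case: unliftP => [j ->|->] //=; by rewrite tnthS.
Qed.

(** Boxes generate the product sigma-algebra and are stable under intersection,
    so the law of an independent uniform family is Lebesgue measure on the
    cube. *)
Lemma iid_uniform_law d (Omega : measurableType d)
    (P : probability Omega R) n (X : Omega -> 'I_n -> R)
    (h : n.-tuple R -> \bar R) :
  iid_uniform P X -> measurable_fun setT h -> (forall y, 0 <= h y) ->
  \int[P]_w h [tuple X w i | i < n] = \int[lebesgue_cube R n]_y h y.
Proof.
move=> [mX PX] mh h0.
pose Y w := [tuple X w i | i < n].
have mY : measurable_fun setT Y.
  apply/measurable_fun_tnthP => i; apply: eq_measurable_fun (mX i) => w _ /=.
  by rewrite tnth_mktuple.
transitivity (\int[pushforward P Y]_y h y).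
  by rewrite ge0_integral_pushforward// preimage_setT.
apply: eq_measure_integral => // B mB _.
pose G := [set [set y : n.-tuple R | forall i, A i (tnth y i)] | A in
  [set A : 'I_n -> set R | forall i, measurable (A i)]].
have GT : G setT.
  by exists (fun=> setT) => //; apply/seteqP; split.
apply: (measure_unique G (fun=> setT)) => //.
- rewrite eqEsubset; split.
    apply: smallest_sub; first exact: smallest_sigma_algebra.
    rewrite -bigcup_seq; apply: bigcup_sub => i _ _ [C mC <-].
    apply: sub_sigma_algebra; exists (fun j => if j == i then C else setT) => /=.
      by move=> j; case: eqP.
    apply/seteqP; split=> [y /(_ i)|y [_ Cy] j]; first by rewrite eqxx.
    by case: eqP => // ->.
  apply: smallest_sub; first exact: sigma_algebra_measurable.
  move=> _ [A mA <-]; apply: measurable_box => // i.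
  exact: measurable_tnth.
- move=> _ _ [A mA <-] [C mC <-]; exists (fun i => A i `&` C i).
    by move=> i; exact: measurableI.
  apply/seteqP; split=> [y AC|y [Ay Cy] i]; last by split; [exact: Ay|exact: Cy].
  by split=> i; case: (AC i).
- by rewrite bigcup_const.
- move=> _ [A mA <-]; apply: etrans (esym (proj2 (iid_uniform_cube n) A mA)).
  rewrite -PX// [LHS]/= /pushforward; congr (P _).
  by apply/seteqP; split=> w Aw i; have := Aw i; rewrite /= tnth_mktuple.
- by move=> _; rewrite [ltLHS]/= /pushforward preimage_setT probability_setT ltry.
Qed.

End iid_families.

(** * The integrand of a homomorphism density *)

Section homomorphism_weight.
Variables (R : realType) (g : graph_function R).

(** A graph function is constrained only on the unit square. Extending it by 0
    gives a function that is measurable, symmetric and bounded everywhere, so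
    that integrals can be taken over whole spaces. *)
Definition gf_ext (x y : R) : R :=
  ((fun p : R * R => g p.1 p.2) \_ (I01 `*` I01)) (x, y).

Lemma gf_extE x y : x \in `[0, 1] -> y \in `[0, 1] -> gf_ext x y = g x y.
Proof. by move=> Ix Iy; rewrite /gf_ext patchE mem_set//; split. Qed.

Lemma gf_ext_itv x y : 0 <= gf_ext x y <= 1.
Proof.
rewrite /gf_ext patchE; case: ifPn => [|_]; last by rewrite lexx ler01.
by rewrite inE => -[/= Ix Iy]; have := @gfun_itv _ g x y Ix Iy; rewrite in_itv.
Qed.

Lemma gf_ext_sym x y : gf_ext x y = gf_ext y x.
Proof.
rewrite /gf_ext !patchE; case: ifPn => [|nI]; rewrite ?inE.
  move=> -[/= Ix Iy]; rewrite mem_set; last by split.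
  exact: gfun_sym.
by case: ifPn => // /[!inE] -[/= Iy Ix]; move: nI; rewrite mem_set//; split.
Qed.

Lemma measurable_gf_ext : measurable_fun setT (fun p : R * R => gf_ext p.1 p.2).
Proof.
rewrite (_ : (fun _ => _) = (fun p : R * R => g p.1 p.2) \_ (I01 `*` I01)).
  apply/(measurable_restrictT _ _).1; last exact: gfun_measurable.
  by apply: measurableX; exact: measurable_itv.
by apply/funext => -[].
Qed.

Definition edge_factor (F : sgraph) (v : F -> R) (a b : F) : R :=
  if edge a b then gf_ext (v a) (v b) else 1.

(** The product over ordered pairs counts each edge twice; its square root is the
    product over the edges, obtained without choosing an orientation or a
    numbering of the vertices. *)
Definition hom_weight (F : sgraph) (v : F -> R) : R :=
  Num.sqrt (\prod_(a : F) \prod_(b : F) edge_factor v a b).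

Lemma edge_factor_itv (F : sgraph) (v : F -> R) a b : 0 <= edge_factor v a b <= 1.
Proof.
by rewrite /edge_factor; case: ifP; rewrite ?gf_ext_itv// ler01 lexx.
Qed.

Lemma edge_factor_prod_itv (F : sgraph) (v : F -> R) :
  0 <= \prod_(a : F) \prod_(b : F) edge_factor v a b <= 1.
Proof.
have H a : 0 <= \prod_(b : F) edge_factor v a b <= 1.
  apply/andP; split.
    by apply: prodr_ge0 => b _; case/andP: (edge_factor_itv v a b).
  by apply: prodr_ile1 => b _; exact: edge_factor_itv.
apply/andP; split; first by apply: prodr_ge0 => b _; case/andP: (H b).
by apply: prodr_ile1 => b _.
Qed.

Lemma hom_weight_itv (F : sgraph) (v : F -> R) : 0 <= hom_weight v <= 1.
Proof.
rewrite sqrtr_ge0 -sqrtr1 ler_wsqrtr//.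
by case/andP: (edge_factor_prod_itv v).
Qed.

Lemma measurable_hom_weight d (Omega : measurableType d) (F : sgraph)
    (X : Omega -> F -> R) :
  (forall a, measurable_fun setT (X ^~ a)) ->
  measurable_fun setT (fun w => hom_weight (X w)).
Proof.
move=> mX; apply: (@measurableT_comp _ _ _ _ _ _ (@Num.sqrt R)).
  by apply: continuous_measurable_fun; exact: sqrt_continuous.
apply: measurable_prod => a _; apply: measurable_prod => b _.
rewrite /edge_factor; case: (edge a b); last exact: measurable_cst.
have mXab : measurable_fun setT (fun w => (X w a, X w b)).
  exact: measurable_fun_pair.
exact: (measurableT_comp measurable_gf_ext mXab).
Qed.

(** Any injective numbering splits the ordered edges into two halves exchanged by
    [(a, b) |-> (b, a)], so the product over all of them is a square. *)
Lemma hom_weight_ordered (F : sgraph) (v : F -> R) (r : F -> nat) :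
  injective r ->
  \prod_(e : F * F | (r e.1 < r e.2)%N && edge e.1 e.2)
    gf_ext (v e.1) (v e.2) = hom_weight v.
Proof.
move=> rinj; set p := LHS.
have p0 : 0 <= p.
  by apply: prodr_ge0 => e _; case/andP: (gf_ext_itv (v e.1) (v e.2)).
rewrite /hom_weight.
suff -> : \prod_(a : F) \prod_(b : F) edge_factor v a b = p ^+ 2.
  by rewrite sqrtr_sqr ger0_norm.
rewrite pair_bigA /= /edge_factor -big_mkcond /=.
rewrite (bigID (fun e => (r e.1 < r e.2)%N)) /= expr2; congr (_ * _).
  by apply: eq_bigl => e; rewrite andbC.
rewrite (reindex_inj (h := fun e : F * F => (e.2, e.1))) /=; last first.
  by move=> [a b] [a' b'] [-> ->].
apply: eq_big => [[a b]|[a b] _] /=; last exact: gf_ext_sym.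
rewrite edge_sym andbC; case: (boolP (edge a b)) => [ab|]; rewrite ?andbT ?andbF//.
rewrite -leqNgt leq_eqVlt; case: eqP => // /rinj ab'.
by move: ab; rewrite ab' edge_irr.
Qed.

Lemma hom_weight_iso (F G : sgraph) (f : F -> G) (v : G -> R) :
  graph_iso f -> hom_weight (v \o f) = hom_weight v.
Proof.
move=> [fbij fmono]; congr Num.sqrt.
rewrite [RHS](reindex f) /=; last exact: onW_bij.
apply: eq_bigr => a _; rewrite [RHS](reindex f) /=; last exact: onW_bij.
by apply: eq_bigr => b _; rewrite /edge_factor fmono.
Qed.

Lemma hom_weight_dunion (F1 F2 : sgraph) (v : dunion F1 F2 -> R) :
  hom_weight v =
  hom_weight (v \o inl : F1 -> R) * hom_weight (v \o inr : F2 -> R).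
Proof.
rewrite -sqrtrM; last by case/andP: (edge_factor_prod_itv (v \o inl : F1 -> R)).
congr Num.sqrt; rewrite big_sumType /=; congr (_ * _); apply: eq_bigr => a _.
  by rewrite big_sumType /= [X in _ * X]big1 ?mulr1.
by rewrite big_sumType /= big1 ?mul1r.
Qed.

Lemma prod_sig (T : finType) (A : pred T) (f : T -> R) :
  \prod_(y | A y) f y = \prod_(y : {y | A y}) f (val y).
Proof.
rewrite (reindex_omap (val : {y | A y} -> T) insub) => [|y Ay]; last by rewrite insubT.
by apply: eq_bigl => y; rewrite valK eqxx andbT (valP y).
Qed.

(** The identified vertex is [i1] on the left and the missing [i2] on the right;
    every edge of the junction comes from exactly one of the two graphs, where
    the cross edges are those of [F2] at [i2]. *)
Lemma hom_weight_junction (F1 F2 : sgraph) (i1 : F1) (i2 : F2)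
    (v : junction i1 i2 -> R) (v1 : F1 -> R) (v2 : F2 -> R) :
  (forall x, v (inl x) = v1 x) -> (forall y, v (inr y) = v2 (val y)) ->
  v1 i1 = v2 i2 ->
  hom_weight v = hom_weight v1 * hom_weight v2.
Proof.
move=> vl vr v12.
rewrite -sqrtrM; last by case/andP: (edge_factor_prod_itv v1).
congr Num.sqrt; rewrite big_sumType /=.
have El x x' : edge_factor v (inl x) (inl x') = edge_factor v1 x x'.
  by rewrite /edge_factor /= !vl.
have Er y y' : edge_factor v (inr y) (inr y') = edge_factor v2 (val y) (val y').
  by rewrite /edge_factor /= !vr.
have Elr x y : edge_factor v (inl x) (inr y) =
    if x == i1 then edge_factor v2 i2 (val y) else 1.
  rewrite /edge_factor /=; case: eqVneq => [->|_] //=.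
  by rewrite vl vr v12.
have Erl y x : edge_factor v (inr y) (inl x) =
    if x == i1 then edge_factor v2 (val y) i2 else 1.
  rewrite /edge_factor /=; case: eqVneq => [->|_] //=.
  by rewrite vl vr v12 edge_sym.
under eq_bigr do rewrite big_sumType /=.
under [X in _ * X]eq_bigr do rewrite big_sumType /=.
rewrite big_split /= -mulrA; congr (_ * _).
  by apply: eq_bigr => a _; apply: eq_bigr => b _.
rewrite (bigD1 i2) //= [X in _ = X * _](bigD1 i2) //=.
have e22 : edge_factor v2 i2 i2 = 1 by rewrite /edge_factor edge_irr.
rewrite e22 mul1r; congr (_ * _).
  rewrite (bigD1 i1) //= [X in _ * X]big1 ?mulr1.
    rewrite [RHS]prod_sig; apply: eq_bigr => y _.
    by rewrite Elr eqxx.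
  by move=> x /negPf xi; apply: big1 => y _; rewrite Elr xi.
rewrite [RHS]prod_sig; apply: eq_bigr => y _.
rewrite (bigD1 i2) //= ; congr (_ * _).
  rewrite (bigD1 i1) //= Erl eqxx big1 ?mulr1// => x /negPf xi.
  by rewrite Erl xi.
by rewrite [RHS]prod_sig; apply: eq_bigr.
Qed.

End homomorphism_weight.

(** * Integrals of functions with values in the unit interval *)

Section unit_valued_integrals.
Variable R : realType.

Lemma unit_integrable d (T : measurableType d) (P : probability T R)
    (f : T -> R) :
  measurable_fun setT f -> (forall x, 0 <= f x <= 1) ->
  P.-integrable setT (EFin \o f).
Proof.
move=> mf f01; apply: measurable_bounded_integrable => //.
  by apply: le_lt_trans (ltry 1); exact: probability_le1.
exists 1; split => // r r1 x _ /=; have /andP[f0 f1] := f01 x.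
by rewrite ger0_norm//; exact: le_trans f1 (ltW r1).
Qed.

Lemma EFin_Rintegral d (T : measurableType d) (P : probability T R)
    (f : T -> R) :
  measurable_fun setT f -> (forall x, 0 <= f x <= 1) ->
  (\int[P]_x f x)%:E = (\int[P]_x (f x)%:E)%E.
Proof.
by move=> mf f01; rewrite fineK//; apply/integrable_fin_num/unit_integrable.
Qed.

Lemma Rintegral_unit d (T : measurableType d) (P : probability T R)
    (f : T -> R) :
  measurable_fun setT f -> (forall x, 0 <= f x <= 1) ->
  0 <= \int[P]_x f x <= 1.
Proof.
move=> mf f01; apply/andP; split.
  by apply: Rintegral_ge0 => x _; case/andP: (f01 x).
rewrite -[leRHS](_ : \int[P]_x 1 = 1).
  apply: le_Rintegral => //; first exact: unit_integrable.
    by apply: unit_integrable => // x; rewrite ler01 lexx.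
  by move=> x _; case/andP: (f01 x).
rewrite Rintegral_cst// mul1r; exact: (congr1 (@fine R) (probability_setT P)).
Qed.

Lemma unit_mul (x y : R) : 0 <= x <= 1 -> 0 <= y <= 1 -> 0 <= x * y <= 1.
Proof.
by move=> /andP[x0 x1] /andP[y0 y1]; rewrite mulr_ge0//= mulr_ile1.
Qed.

Section product.
Context d1 d2 (T1 : measurableType d1) (T2 : measurableType d2).
Variables (P1 : probability T1 R) (P2 : probability T2 R).

Lemma measurable_section (f : T1 * T2 -> R) x :
  measurable_fun setT f -> measurable_fun setT (fun y => f (x, y)).
Proof. by move=> mf; exact: (measurableT_comp mf (pair1_measurable x)). Qed.

Lemma EFin_Rintegral_section (f : T1 * T2 -> R) :
  measurable_fun setT f -> (forall p, 0 <= f p <= 1) ->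
  EFin \o (fun x => \int[P2]_y f (x, y)) = fubini_F P2 (EFin \o f).
Proof.
move=> mf f01; apply/funext => x /=; rewrite EFin_Rintegral//.
exact: measurable_section.
Qed.

Lemma measurable_Rintegral_section (f : T1 * T2 -> R) :
  measurable_fun setT f -> (forall p, 0 <= f p <= 1) ->
  measurable_fun setT (fun x => \int[P2]_y f (x, y)).
Proof.
move=> mf f01; apply/measurable_EFinP.
rewrite EFin_Rintegral_section//; apply: measurable_fun_fubini_tonelli_F.
  exact/measurable_EFinP.
by move=> p; rewrite lee_fin; case/andP: (f01 p).
Qed.

Lemma Rintegral_prod (f : T1 * T2 -> R) :
  measurable_fun setT f -> (forall p, 0 <= f p <= 1) ->
  \int[(P1 \x P2)%E]_p f p = \int[P1]_x \int[P2]_y f (x, y).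
Proof.
move=> mf f01; rewrite /Rintegral; congr fine.
have /= := EFin_Rintegral_section mf f01.
move=> /(congr1 (fun h => \int[P1]_x h x)%E) /= ->.
rewrite fubini_tonelli1//; first exact/measurable_EFinP.
by move=> p; rewrite lee_fin; case/andP: (f01 p).
Qed.

Lemma Rintegral_prod_mul (f1 : T1 -> R) (f2 : T2 -> R) :
  measurable_fun setT f1 -> (forall x, 0 <= f1 x <= 1) ->
  measurable_fun setT f2 -> (forall y, 0 <= f2 y <= 1) ->
  \int[(P1 \x P2)%E]_p (f1 p.1 * f2 p.2) = \int[P1]_x f1 x * \int[P2]_y f2 y.
Proof.
move=> mf1 f101 mf2 f201.
rewrite (Rintegral_prod (f := fun p => f1 p.1 * f2 p.2)) /=; last 2 first.
- apply: measurable_funM; first exact: (measurableT_comp mf1).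
  exact: (measurableT_comp mf2).
- by move=> p; exact: unit_mul.
rewrite -RintegralZr//; last exact: unit_integrable.
by apply: eq_Rintegral => x _; rewrite RintegralZl//; exact: unit_integrable.
Qed.

End product.

End unit_valued_integrals.

(** * Homomorphism densities as expectations *)

Section density_expectation.
Variables (R : realType) (g : graph_function R).

Definition coords (F : sgraph) (y : #|F|.-tuple R) (a : F) : R :=
  tnth y (enum_rank a).

Lemma iid_coords (F : sgraph) : iid_uniform (lebesgue_cube R #|F|) (@coords F).
Proof.
exact: iid_uniform_reindex (@enum_rank_inj F) (iid_uniform_cube R #|F|).
Qed.

Lemma iid_hom_weight d (Omega : measurableType d) (P : probability Omega R)
    (F : sgraph) (X : Omega -> F -> R) :
  iid_uniform P X ->
  (\int[P]_w (hom_weight g (X w))%:E =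
   \int[lebesgue_cube R #|F|]_y (hom_weight g (coords y))%:E)%E.
Proof.
move=> iidX.
have iidX' := iid_uniform_reindex (@enum_val_inj F predT) iidX.
rewrite -(iid_uniform_law iidX').
- apply: eq_integral => w _; congr (hom_weight g _)%:E; apply/funext => a.
  by rewrite /coords tnth_mktuple enum_rankK.
- apply/measurable_EFinP; apply: measurable_hom_weight => a.
  exact: measurable_tnth.
- by move=> y; rewrite lee_fin; case/andP: (hom_weight_itv g (coords y)).
Qed.

Lemma lebesgue_cube_cube n : lebesgue_cube R n (@cube R n) = 1%E.
Proof.
transitivity (\prod_(i < n) lebesgue01 (@I01 R))%E.
  exact: (proj2 (iid_uniform_cube R n) (fun=> I01) (fun=> measurable_itv _)).
rewrite big1// => i _.
by rewrite /lebesgue01 setIid -(lebesgue01_setT R) /lebesgue01 setTI.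
Qed.

Lemma measurable_cube n : measurable (@cube R n).
Proof.
apply: (@measurable_box _ _ _ _ (@tnth n R) (fun=> I01)) => i.
  exact: measurable_tnth.
exact: measurable_itv.
Qed.

Lemma lebesgue_cube_cubeC n : lebesgue_cube R n (~` @cube R n) = 0%E.
Proof.
have := probability_setC (lebesgue_cube R n) (@measurable_cube n).
by move=> ->; have -> := lebesgue_cube_cube n; rewrite subee.
Qed.

(** Replacing the graph function by its extension changes the integrand only
    outside the cube, which is negligible. *)
Lemma gf_hom_densityE (F : sgraph) :
  gf_hom_density F g = \int[lebesgue_cube R #|F|]_y hom_weight g (coords y).
Proof.
rewrite /gf_hom_density /Rintegral; congr fine.
have mW : measurable_fun setT (fun y : #|F|.-tuple R => hom_weight g (coords y)).
  by apply: measurable_hom_weight => a; exact: measurable_tnth.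
rewrite [RHS](ge0_negligible_integral (N := ~` @cube R #|F|)) //; last 4 first.
- by apply: measurableC; exact: measurable_cube.
- exact/measurable_EFinP.
- by move=> y _; rewrite lee_fin; case/andP: (hom_weight_itv g (coords y)).
- exact: lebesgue_cube_cubeC.
rewrite setTD setCK; apply: eq_integral => y; rewrite inE => Iy; congr EFin.
rewrite -(hom_weight_ordered g (coords y) (r := fun a : F => enum_rank a)).
  by apply: eq_bigr => e _; rewrite gf_extE//; exact: Iy.
by move=> a b /val_inj/enum_rank_inj.
Qed.

Lemma gf_hom_density_iid d (Omega : measurableType d)
    (P : probability Omega R) (F : sgraph) (X : Omega -> F -> R) :
  iid_uniform P X ->
  gf_hom_density F g = \int[P]_w hom_weight g (X w).
Proof.
by move=> /iid_hom_weight iidX; rewrite gf_hom_densityE /Rintegral iidX.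
Qed.

Lemma gf_hom_density_iso (F G : sgraph) :
  isomorphic F G -> gf_hom_density F g = gf_hom_density G g.
Proof.
move=> [f fiso].
have finj : injective f by apply: bij_inj; case: fiso.
rewrite (gf_hom_density_iid (iid_uniform_reindex finj (iid_coords G))).
rewrite gf_hom_densityE; apply: eq_Rintegral => y _.
exact: (hom_weight_iso g (coords y) fiso).
Qed.

End density_expectation.

(** * Rooted densities *)

Section rooted_densities.
Variables (R : realType) (g : graph_function R).

Definition reroot (F : sgraph) (i : F) (t : R) (v : F -> R) : F -> R :=
  fun a => if a == i then t else v a.

(** The integration runs over all the coordinates, the one of [i] being overwritten
    by [t]: as the measure is a probability, this equals the integral over the
    other coordinates, and no vertex has to be removed from the index set. *)
Definition rooted_density (F : sgraph) (i : F) (t : R) : R :=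
  \int[lebesgue_cube R #|F|]_y hom_weight g (reroot i t (coords y)).

Lemma measurable_reroot_weight (F : sgraph) (i : F) :
  measurable_fun setT (fun p : R * #|F|.-tuple R =>
    hom_weight g (reroot i p.1 (coords p.2))).
Proof.
apply: measurable_hom_weight => a; rewrite /reroot.
case: (a == i); first exact: measurable_fst.
exact: (measurableT_comp (proj1 (iid_coords R F) a) measurable_snd).
Qed.

Lemma measurable_reroot_weight_section (F : sgraph) (i : F) t :
  measurable_fun setT (fun y : #|F|.-tuple R =>
    hom_weight g (reroot i t (coords y))).
Proof. exact: measurable_section (measurable_reroot_weight i). Qed.

Lemma rooted_density_itv (F : sgraph) (i : F) t :
  0 <= rooted_density i t <= 1.
Proof.
apply: Rintegral_unit => [|y]; last exact: hom_weight_itv.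
exact: measurable_reroot_weight_section.
Qed.

Lemma measurable_rooted_density (F : sgraph) (i : F) :
  measurable_fun setT (rooted_density i).
Proof.
apply: (measurable_Rintegral_section _ (measurable_reroot_weight i)) => p.
exact: hom_weight_itv.
Qed.

(** An automorphism [f] permutes the integration variables and moves the root from
    [f i] to [i]. *)
Lemma rooted_density_iso (F : sgraph) (f : F -> F) (i : F) t :
  graph_iso f -> rooted_density (f i) t = rooted_density i t.
Proof.
move=> fiso; have finj : injective f by apply: bij_inj; case: fiso.
have iidf := iid_uniform_reindex (@enum_val_inj F predT)
  (iid_uniform_reindex finj (iid_coords R F)).
rewrite /rooted_density /Rintegral; congr fine.
rewrite -[RHS](iid_uniform_law iidf); last 2 first.
- by apply/measurable_EFinP; exact: measurable_reroot_weight_section.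
- move=> y; rewrite lee_fin.
  by case/andP: (hom_weight_itv g (reroot i t (coords y))).
apply: eq_integral => y _; congr EFin.
rewrite -(hom_weight_iso g (reroot (f i) t (coords y)) fiso).
congr hom_weight; apply/funext => a.
by rewrite /reroot /= (inj_eq finj) /coords tnth_mktuple enum_rankK.
Qed.

(** The coordinate of [i], which the root overwrites, is independent of all the
    others: the root and the remaining coordinates again form an independent
    uniform family. *)
Lemma Rintegral_rooted_density (F : sgraph) (i : F) :
  \int[@lebesgue01 R]_t rooted_density i t = gf_hom_density F g.
Proof.
pose h (a : F) : (unit + F)%type := if a == i then inl tt else inr a.
have hinj : injective h.
  by move=> a b; rewrite /h; case: (eqVneq a i) => [->|_];
    case: (eqVneq b i) => [->|_]// [].
rewrite (gf_hom_density_iid g (iid_uniform_reindex hinj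
  (iid_uniform_sum (iid_uniform1 R) (iid_coords R F)))).
rewrite /rooted_density -(Rintegral_prod _ _ (f := fun p =>
  hom_weight g (reroot i p.1 (coords p.2)))); last 2 first.
- exact: measurable_reroot_weight.
- by move=> p; exact: hom_weight_itv.
apply: eq_Rintegral => p _; congr hom_weight; apply/funext => a.
by rewrite /reroot /h; case: ifP.
Qed.

(** An independent uniform family on the vertices of the junction is drawn from a
    common root and two independent families, one per graph; for a fixed root the
    integrand is a product of functions of the two families. *)
Lemma gf_hom_density_junction (F1 F2 : sgraph) (i1 : F1) (i2 : F2) :
  gf_hom_density (junction i1 i2) g =
  \int[@lebesgue01 R]_t (rooted_density i1 t * rooted_density i2 t).
Proof.
pose h (a : junction i1 i2) : (unit + (F1 + F2))%type :=
  match a with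
  | inl x => if x == i1 then inl tt else inr (inl x)
  | inr y => inr (inr (val y))
  end.
have hinj : injective h.
  move=> [a|a] [b|b]; rewrite /h.
  - by case: (eqVneq a i1) => [->|_]; case: (eqVneq b i1) => [->|_]// [->].
  - by case: (a == i1).
  - by case: (b == i1).
  - by move=> [] /val_inj ->.
have iidX := iid_uniform_reindex hinj (iid_uniform_sum (iid_uniform1 R)
  (iid_uniform_sum (iid_coords R F1) (iid_coords R F2))).
have mX := proj1 iidX.
rewrite (gf_hom_density_iid g iidX).
rewrite Rintegral_prod; last 2 first.
- exact: measurable_hom_weight.
- by move=> p; exact: hom_weight_itv.
apply: eq_Rintegral => t _; rewrite -Rintegral_prod_mul; last 4 first.
- exact: measurable_reroot_weight_section.
- by move=> y; exact: hom_weight_itv.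
- exact: measurable_reroot_weight_section.
- by move=> y; exact: hom_weight_itv.
apply: eq_Rintegral => q _; apply: hom_weight_junction => [x|y|].
- by rewrite /h /reroot; case: (x == i1).
- by rewrite /h /reroot (negPf (valP y)).
- by rewrite /reroot !eqxx.
Qed.

Lemma gf_hom_density_dunion (F1 F2 : sgraph) :
  gf_hom_density (dunion F1 F2) g = gf_hom_density F1 g * gf_hom_density F2 g.
Proof.
rewrite (gf_hom_density_iid (F := dunion F1 F2) g
  (iid_uniform_sum (iid_coords R F1) (iid_coords R F2))).
rewrite !gf_hom_densityE -Rintegral_prod_mul; last 4 first.
- by apply: measurable_hom_weight; exact: (proj1 (iid_coords R F1)).
- by move=> y; exact: hom_weight_itv.
- by apply: measurable_hom_weight; exact: (proj1 (iid_coords R F2)).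
- by move=> y; exact: hom_weight_itv.
by apply: eq_Rintegral => p _; rewrite hom_weight_dunion.
Qed.

End rooted_densities.

(** * Factorization over junctions with transitive graphs *)

Section variance.
Variable R : realType.

(** The two moments say that [f] has mean [c] and variance 0, so [f] is almost
    everywhere equal to [c]. *)
Lemma zero_variance_mul d (T : measurableType d) (P : probability T R)
    (f h : T -> R) (c : R) :
  measurable_fun setT f -> (forall x, 0 <= f x <= 1) ->
  measurable_fun setT h -> (forall x, 0 <= h x <= 1) ->
  \int[P]_x f x = c -> \int[P]_x (f x * f x) = c ^+ 2 ->
  \int[P]_x (h x * f x) = \int[P]_x h x * c.
Proof.
move=> mf f01 mh h01 Ef Eff.
have c01 : 0 <= c <= 1 by rewrite -Ef Rintegral_unit.
pose q x := (f x - c) * (f x - c).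
have mq : measurable_fun setT q by apply: measurable_funM; exact: measurable_funB.
have q01 x : 0 <= q x <= 1.
  rewrite /q -expr2 sqr_ge0 -real_normK ?num_real// exprn_ile1//.
  by have := f01 x; move: c01; rewrite ler_norml; lra.
have mcf : measurable_fun setT (fun x => c * f x) by exact: measurable_funM.
have cf01 x : 0 <= c * f x <= 1 by exact: unit_mul.
have Eq : \int[P]_x q x = 0.
  (* The expansion of the square is arranged so that each integrand takes its
     values in the unit interval. *)
  have : \int[P]_x (f x * f x) + \int[P]_x (c * c) =
      \int[P]_x q x + \int[P]_x (c * f x) + \int[P]_x (c * f x).
    rewrite -RintegralD//; last 2 first.
    - by apply: unit_integrable => [|x]; [exact: measurable_funM|exact: unit_mul].
    - by apply: unit_integrable => // x; exact: unit_mul.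
    rewrite -addrA -RintegralD//; [|exact: unit_integrable|exact: unit_integrable].
    rewrite -RintegralD//; [|exact: unit_integrable|].
      by apply: eq_Rintegral => x _; rewrite /q; ring.
    have icf := unit_integrable P mcf cf01.
    exact: (integrableD measurableT icf icf).
  have c1 : \int[P]_x (c * c) = c * c.
    rewrite Rintegral_cst// -[RHS]mulr1; congr (_ * _).
    exact: (congr1 (@fine R) (probability_setT P)).
  rewrite c1 RintegralZl//; last exact: unit_integrable.
  by rewrite Eff Ef; lra.
have fc : ae_eq P setT (EFin \o q) (cst 0%E).
  apply/ae_eq_integral_abs => //; first exact/measurable_EFinP.
  rewrite (eq_integral (fun x => (q x)%:E)).
    by rewrite -EFin_Rintegral// Eq.
  by move=> x _; rewrite gee0_abs// lee_fin; case/andP: (q01 x).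
rewrite -RintegralZr//; last exact: unit_integrable.
rewrite /Rintegral; congr fine; apply: ae_eq_integral => //.
- by apply/measurable_EFinP; exact: measurable_funM.
- by apply/measurable_EFinP; exact: measurable_funM.
apply: filterS fc => x /= /(_ I) [] /eqP qx _.
by move: qx; rewrite mulf_eq0 orbb subr_eq0 => /eqP ->.
Qed.
End variance.

(** By transitivity all the junctions of [F'] with itself have the same density,
    the second moment of a rooted density of [F']; singularity equates it with
    the square of its mean. *)
Lemma hom_density_junction_transitive (R : realType) (gamma : graphon R)
    (F F' : sgraph) (i : F) (j : F') :
  singular gamma -> vertex_transitive F' ->
  hom_density (junction i j) gamma = hom_density F gamma * hom_density F' gamma.
Proof.
move=> sing trF'; rewrite /hom_density; set g := graphon_repr gamma.
have rE (k : F') : rooted_density g k = rooted_density g j :> (R -> R).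
  apply/funext => t; have [f fiso <-] := trF' j k.
  exact: rooted_density_iso.
rewrite gf_hom_density_junction -(Rintegral_rooted_density g i).
apply: zero_variance_mul; do ?exact: measurable_rooted_density;
  do ?exact: rooted_density_itv.
- exact: Rintegral_rooted_density.
have := sing F' F'; rewrite /hom_density -/g gf_hom_density_dunion -expr2 => ->.
under eq_bigr => k _ do under eq_bigr => l _ do
  rewrite gf_hom_density_junction !rE.
have F'0 : #|F'|%:R != 0 :> R by rewrite pnatr_eq0 -lt0n vertex_gt0.
rewrite !sumr_const -mulrnA -[X in _ * X]mulr_natl natrM mulKf//.
by rewrite mulf_neq0.
Qed.

Theorem theorem20 (R : realType) (gamma : graphon R) (hgamma : singular gamma)
    (s : seq sgraph) (F : sgraph) (hF : join_transitive_of s F) :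
  hom_density F gamma = \prod_(G <- s) hom_density G gamma.
Proof.
have [F' jF' FF'] := hF.
rewrite {1}/hom_density (gf_hom_density_iso _ FF') -/(hom_density F' gamma).
elim: jF' => {F hF F' FF'} [F trF|s' F F' i j _ IH trF'].
  by rewrite big_seq1.
by rewrite hom_density_junction_transitive// IH -cats1 big_cat big_seq1.
Qed.
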